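(* Let $T$ be a self-converse tournament with at least two vertices. Then for every integer $m\ge 1$, $$\operatorname{pal}_T(m)=\operatorname{ex}_2^+(m,T),$$ where $$\operatorname{pal}_T(m)=\max\{|\mathcal A(\mathcal P)| : \mathcal P \text{ a palette},\ |\mathcal C(\mathcal P)|=m,\ \mathcal P_T^L\not\preceq\mathcal P,\ \mathcal P_T^R\not\preceq\mathcal P\}$$ and $$\operatorname{ex}_2^+(m,T)=\max\Big\{\sum_{v\in V(D)}d_D^+(v)^2 : |V(D)|=m,\ D\text{ is a } T\text{-free loopless digraph}\Big\}.$$
   Context: Digraphs are finite and loopless; digons (pairs of opposite arcs on the same two vertices) are allowed, and opposite arcs are counted separately. $A(D)$ is the arc set and $d_D^+(v)$ the out-degree. A digraph is $F$-free if it contains no (not necessarily induced) subdigraph isomorphic to $F$. $D^{\mathrm{rev}}$ is $D$ with all arcs reversed; $D$ is self-converse if $D\cong D^{\mathrm{rev}}$. A palette is a pair $\mathcal P=(\mathcal C,\mathcal A)$ where $\mathcal C=\mathcal C(\mathcal P)$ is a finite set of colors and $\mathcal A=\mathcal A(\mathcal P)\subseteq\mathcal C^3$ is a set of admissible ordered triples (repeated colors allowed). A homomorphism $\mathcal P\to\mathcal P'$ is a map $f:\mathcal C(\mathcal P)\to\mathcal C(\mathcal P')$ such that $(a,b,c)\in\mathcal A(\mathcal P)$ implies $(f(a),f(b),f(c))\in\mathcal A(\mathcal P')$; write $\mathcal P\preceq\mathcal P'$ if one exists, and $\mathcal P\not\preceq\mathcal P'$ otherwise. For a loopless digraph $D$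 let $\mathcal C_D=V(D)\sqcup\{c_{uv}:uv\in A(D)\}$, where the $c_{uv}$ are new distinct colors, one per arc. The left and right palettes generated by $D$ are $\mathcal P_D^L=(\mathcal C_D,\{(u,v,c_{uv}):uv\in A(D)\})$ and $\mathcal P_D^R=(\mathcal C_D,\{(c_{uv},u,v):uv\in A(D)\})$. *)

(* Defs.v *)
From HB Require Import structures.
From mathcomp Require Import all_boot.

Set Implicit Arguments.
Unset Strict Implicit.
Unset Printing Implicit Defensive.

(* Loopless digraphs with vertex set V.  Both (u, v) and (v, u) may be arcs. *)
Record digraph (V : finType) := Digraph {
  arcs :> {set V * V};
  _ : [forall v, (v, v) \notin arcs] }.

HB.instance Definition _ (V : finType) := [isSub for @arcs V].
HB.instance Definition _ (V : finType) := [Finite of digraph V by <:].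

Definition outdeg (V : finType) (D : digraph V) (v : V) : nat :=
  #|[set w | (v, w) \in arcs D]|.

Definition tournament (V : finType) (D : digraph V) : Prop :=
  forall u v : V, u != v -> ((u, v) \in arcs D) (+) ((v, u) \in arcs D).

Lemma revdi_proof (V : finType) (D : digraph V) :
  [forall v, (v, v) \notin [set a : V * V | (a.2, a.1) \in arcs D]].
Proof. by case: D => A /= /forallP nA; apply/forallP=> v; rewrite inE. Qed.

Definition revdi (V : finType) (D : digraph V) : digraph V :=
  Digraph (revdi_proof D).

Definition digraph_iso (V W : finType) (D : digraph V) (E : digraph W) : Prop :=
  exists f : V -> W, bijective f /\
    forall u v, ((f u, f v) \in arcs E) = ((u, v) \in arcs D).

Definition self_converse (V : finType) (D : digraph V) : Prop :=
  digraph_iso D (revdi D).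

(* D contains a copy of F: the vertices f u and the arcs (f u, f v), for (u, v)
   an arc of F, form a (not necessarily induced) subdigraph isomorphic to F. *)
Definition contains (V W : finType) (D : digraph V) (F : digraph W) : bool :=
  [exists f : {ffun W -> V}, injectiveb f &&
    [forall u, forall v,
      ((u, v) \in arcs F) ==> ((f u, f v) \in arcs D)]].

Definition free_of (W V : finType) (F : digraph W) (D : digraph V) : bool :=
  ~~ contains D F.

(* A palette with color set C is its set of admissible triples. *)
Definition palette (C : finType) : Type := {set C * C * C}.

Definition palette_hom (C C' : finType) (P : palette C) (P' : palette C') : bool :=
  [exists f : {ffun C -> C'}, forall a, forall b, forall c,
    ((a, b, c) \in P) ==> ((f a, f b, f c) \in P')].

Definition arc_of (V : finType) (D : digraph V) : finType :=
  {a : V * V | a \in arcs D}.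

Definition colors_of (V : finType) (D : digraph V) : finType :=
  (V + arc_of D)%type.

Definition left_palette (V : finType) (D : digraph V) : palette (colors_of D) :=
  [set (inl (val a).1, inl (val a).2, inr a) | a : arc_of D].

Definition right_palette (V : finType) (D : digraph V) : palette (colors_of D) :=
  [set (inr a, inl (val a).1, inl (val a).2) | a : arc_of D].

Definition pal_ok (V C : finType) (T : digraph V) (P : palette C) : bool :=
  ~~ palette_hom (left_palette T) P && ~~ palette_hom (right_palette T) P.

Definition outdeg2_sum (V : finType) (D : digraph V) : nat :=
  \sum_(v : V) outdeg D v ^ 2.

(* The maxima below range over 'I_m as the m-element set of colors, resp. of
   vertices.  The lemmas at the end of the file show that these are the maxima
   over all m-element sets, and that they are attained as soon as T has an arc
   (so that the value 0 of an empty \max plays no role). *)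
Definition pal (V : finType) (T : digraph V) (m : nat) : nat :=
  \max_(P : {set 'I_m * 'I_m * 'I_m} | pal_ok T P) #|P|.

Definition ex2 (V : finType) (m : nat) (T : digraph V) : nat :=
  \max_(D : digraph 'I_m | free_of T D) outdeg2_sum D.

Lemma palette_homP (C C' : finType) (P : palette C) (P' : palette C') :
  reflect (exists f : C -> C',
             forall a b c, (a, b, c) \in P -> (f a, f b, f c) \in P')
          (palette_hom P P').
Proof.
apply: (iffP existsP) => [[f /'forall_forallP fP]|[f fP]].
  by exists f => a b c abc; have /forallP/(_ c)/implyP := fP a b; apply.
exists [ffun x => f x]; apply/'forall_forallP=> a b; apply/forallP=> c.
by apply/implyP=> /fP; rewrite !ffunE.
Qed.

Lemma containsP (V W : finType) (D : digraph V) (F : digraph W) :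
  reflect (exists2 f : W -> V, injective f &
             forall u v, (u, v) \in arcs F -> (f u, f v) \in arcs D)
          (contains D F).
Proof.
apply: (iffP existsP) => [[f /andP[/injectiveP fI /'forall_forallP fP]]|[f fI fP]].
  by exists f => // u v uv; have /implyP := fP u v; apply.
exists [ffun x => f x]; apply/andP; split.
  by apply/injectiveP=> x y; rewrite !ffunE => /fI.
by apply/'forall_forallP=> u v; apply/implyP=> /fP; rewrite !ffunE.
Qed.

Lemma pal_max (V C : finType) (T : digraph V) (P : palette C) :
  pal_ok T P -> #|P| <= pal T #|C|.
Proof.
pose g (x : C * C * C) := (enum_rank x.1.1, enum_rank x.1.2, enum_rank x.2).
have gI : injective g.
  by move=> [[a b] c] [[a' b'] c'] [] /enum_rank_inj-> /enum_rank_inj->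
     /enum_rank_inj->.
move=> okP; rewrite -(card_imset (mem P) gI).
apply: (leq_bigmax_cond (F := fun Q : {set _} => #|Q|)).
have back (D : finType) (Q : palette D) : palette_hom Q (g @: P) -> palette_hom Q P.
  move=> /palette_homP[f fP]; apply/palette_homP.
  exists (fun x => enum_val (f x)) => a b c /fP/imsetP[[[x y] z] Pxyz].
  by rewrite /g /= => -[-> -> ->]; rewrite !enum_rankK.
by case/andP: okP => nL nR; apply/andP; split; [apply: contra nL | apply: contra nR];
  apply: back.
Qed.

Lemma pal_attained (V : finType) (T : digraph V) (m : nat) :
  arcs T != set0 -> exists2 P : palette 'I_m, pal_ok T P & #|P| = pal T m.
Proof.
case/set0Pn=> a aT; pose e : arc_of T := exist _ a aT.
have ok0 : pal_ok T (set0 : palette 'I_m).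
  apply/andP; split; apply/palette_homP=> -[f fP].
    by have := fP _ _ _ (imset_f _ (isT : e \in predT)); rewrite inE.
  by have := fP _ _ _ (imset_f _ (isT : e \in predT)); rewrite inE.
have c0 : 0 < #|pal_ok T (C := 'I_m)| by apply/card_gt0P; exists set0.
have [P okP eP] := eq_bigmax_cond (fun Q : {set _} => #|Q|) c0.
by exists P; rewrite // -eP.
Qed.

Lemma ex2_max (V W : finType) (T : digraph V) (D : digraph W) :
  free_of T D -> outdeg2_sum D <= ex2 #|W| T.
Proof.
move=> frD; pose r := @enum_rank W.
pose A := [set p : 'I_#|W| * 'I_#|W| | (enum_val p.1, enum_val p.2) \in arcs D].
have nA : [forall v, (v, v) \notin A].
  apply/forallP=> v; rewrite inE /=.
  by case: (D) => B /= /forallP.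
pose E := Digraph nA.
have -> : outdeg2_sum D = outdeg2_sum E.
  rewrite /outdeg2_sum (reindex (@enum_val W predT)) /=; last first.
    exact/onW_bij/enum_val_bij.
  apply: eq_bigr => i _; congr (_ ^ 2); rewrite /outdeg.
  rewrite -(card_imset (mem [set w | (i, w) \in arcs E]) (@enum_val_inj _ _)).
  apply: eq_card => w; rewrite inE; apply/idP/imsetP => [iw|[j]].
    by exists (enum_rank w); rewrite ?inE /= ?enum_rankK.
  by rewrite !inE /= => ij ->.
apply: (leq_bigmax_cond (F := fun D : digraph 'I_#|W| => outdeg2_sum D)).
apply: contra frD => /containsP[f fI fP]; apply/containsP.
exists (fun x => enum_val (f x)) => [x y /enum_val_inj/fI //|u v /fP].
by rewrite inE.
Qed.

Lemma ex2_attained (V : finType) (T : digraph V) (m : nat) :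
  arcs T != set0 -> exists2 D : digraph 'I_m, free_of T D & outdeg2_sum D = ex2 m T.
Proof.
case/set0Pn=> -[u v] uvT.
have n0 : [forall v, (v, v) \notin (set0 : {set 'I_m * 'I_m})].
  by apply/forallP=> x; rewrite inE.
have c0 : 0 < #|free_of T (V := 'I_m)|.
  apply/card_gt0P; exists (Digraph n0); apply/containsP=> -[f _ /(_ _ _ uvT)].
  by rewrite inE.
have [D frD eD] := eq_bigmax_cond (fun D : digraph 'I_m => outdeg2_sum D) c0.
by exists D; rewrite // -eD.
Qed.

(* Main.v *)
(** A palette avoids the left (resp. right) palette of a tournament T exactly
    when its projection to the first (resp. last) two coordinates is a loopless
    T-free digraph: a homomorphism from a tournament to a loopless digraph is
    injective, and a loop admits a constant one.  With L and R these two
    projections, the number of admissible triples is at most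
    \sum_b indeg_L(b) * outdeg_R(b).  As T is self-converse, the converse of L
    is T-free too, so AM-GM gives the upper bound; for the lower bound take
    R = D and L the converse of D, for an optimal T-free digraph D. *)
Require Import Defs.
From mathcomp Require Import all_boot.

(** Each arc color lies in exactly one triple of the left palette, so its image can be chosen
    separately for every arc. *)
Lemma left_palette_homP (V C : finType) (T : digraph V) (P : palette C) :
  reflect (exists f : V -> C, forall u v, (u, v) \in arcs T ->
             exists c, (f u, f v, c) \in P)
          (palette_hom (left_palette T) P).
Proof.
apply: (iffP (palette_homP _ _)) => [[f fP]|[f fP]].
  exists (fun v => f (inl v)) => u v uvT; exists (f (inr (exist _ (u, v) uvT))).
  by apply: fP; apply/imsetP; exists (exist _ (u, v) uvT).
have fP' (a : arc_of T) : exists c, (f (val a).1, f (val a).2, c) \in P.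
  by case: a => -[u v] /= /fP.
exists (fun x => match x with inl v => f v | inr a => xchoose (fP' a) end).
move=> a b c /imsetP[e _ [-> -> ->]]; exact: (xchooseP (fP' e)).
Qed.

Lemma right_palette_homP (V C : finType) (T : digraph V) (P : palette C) :
  reflect (exists f : V -> C, forall u v, (u, v) \in arcs T ->
             exists a, (a, f u, f v) \in P)
          (palette_hom (right_palette T) P).
Proof.
apply: (iffP (palette_homP _ _)) => [[f fP]|[f fP]].
  exists (fun v => f (inl v)) => u v uvT; exists (f (inr (exist _ (u, v) uvT))).
  by apply: fP; apply/imsetP; exists (exist _ (u, v) uvT).
have fP' (a : arc_of T) : exists c, (c, f (val a).1, f (val a).2) \in P.
  by case: a => -[u v] /= /fP.
exists (fun x => match x with inl v => f v | inr a => xchoose (fP' a) end).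
move=> a b c /imsetP[e _ [-> -> ->]]; exact: (xchooseP (fP' e)).
Qed.

Lemma digraph_irrefl (V : finType) (D : digraph V) v : (v, v) \notin arcs D.
Proof. by case: D => A /= /forallP. Qed.

Lemma tournament_hom_contains (V W : finType) (T : digraph V) (D : digraph W)
    (f : V -> W) :
  tournament T -> (forall u v, (u, v) \in arcs T -> (f u, f v) \in arcs D) ->
  contains D T.
Proof.
move=> hT fP; apply/containsP; exists f => // u v fuv; apply/eqP.
(* Distinct [u] and [v] span an arc one way or the other; if [f u = f v], its image is a loop. *)
apply: contraT => /hT/addbP; case: (boolP ((u, v) \in _)) => [/fP|_ /esym/fP];
  by rewrite fuv (negPf (digraph_irrefl _ _ _)).
Qed.

Lemma self_converse_contains_rev (V W : finType) (T : digraph V)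
    (D : digraph W) :
  self_converse T -> contains (revdi D) T -> contains D T.
Proof.
move=> [g [gB gP]] /containsP[f fI fP]; apply/containsP; exists (f \o g).
  by apply: inj_comp => //; apply: bij_inj.
by move=> u v uvT; have := gP u v; rewrite uvT inE /= => /fP; rewrite inE.
Qed.

(** Both arcs leave the middle color, so that only out-degrees enter the count; the first two
    coordinates then project into the converse of [D1]. *)
Definition cherries {C : finType} (D1 D2 : digraph C) : palette C :=
  [set t | ((t.1.2, t.1.1) \in arcs D1) && ((t.1.2, t.2) \in arcs D2)].

Lemma card_cherries (C : finType) (D1 D2 : digraph C) :
  #|cherries D1 D2| = \sum_v outdeg D1 v * outdeg D2 v.
Proof.
(* The triples with middle color [v] form a product of two out-neighbourhoods of [v]. *)
rewrite -sum1_card (partition_big (fun t : C * C * C => t.1.2) predT) //=.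
apply: eq_bigr => v _; rewrite /outdeg -cardsX sum1_card.
pose h (p : C * C) := (p.1, v, p.2).
have hI : injective h by move=> [a c] [a' c'] [-> ->].
rewrite -(card_imset _ hI); apply: eq_card => -[[a b] c].
rewrite unfold_in /= inE /=; apply/andP/imsetP => [[/andP[ba bc] /eqP eb]|].
  by exists (a, c); rewrite /h ?inE /= -eb ?ba.
by case=> -[a' c']; rewrite !inE /= => /andP[va vc] [-> -> ->]; rewrite va vc eqxx.
Qed.

Lemma ex2_le_pal (V : finType) (T : digraph V) (m : nat) :
  tournament T -> self_converse T -> ex2 m T <= pal T m.
Proof.
move=> hT hself; apply/bigmax_leqP=> D frD.
have -> : outdeg2_sum D = #|cherries D D|.
  by rewrite card_cherries; apply: eq_bigr => v _; rewrite mulnn.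
apply: (leq_bigmax_cond (F := fun Q : {set _} => #|Q|)).
apply/andP; split; apply: contra frD.
  case/left_palette_homP=> f fP; apply: self_converse_contains_rev => //.
  apply: (@tournament_hom_contains _ _ _ _ f) => // u v /fP[c].
  by rewrite !inE => /andP[].
case/right_palette_homP=> f fP.
apply: (@tournament_hom_contains _ _ _ _ f) => // u v /fP[c].
by rewrite !inE => /andP[].
Qed.

Lemma pal_ok_sub_cherries (V C : finType) (T : digraph V) (P : palette C) :
  self_converse T -> pal_ok T P ->
  exists D1 D2 : digraph C,
    [/\ free_of T D1, free_of T D2 & P \subset cherries D1 D2].
Proof.
move=> hself /andP[/left_palette_homP nL /right_palette_homP nR].
have A1 : [forall v, (v, v) \notin [set p | [exists c, (p.2, p.1, c) \in P]]].
  apply/forallP=> v; rewrite inE; apply/existsP=> -[c vvc].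
  (* A loop at [v] would make the constant map to [v] a homomorphism. *)
  by apply: nL; exists (fun=> v) => *; exists c.
have A2 : [forall v, (v, v) \notin [set p | [exists a, (a, p.1, p.2) \in P]]].
  apply/forallP=> v; rewrite inE; apply/existsP=> -[a avv].
  by apply: nR; exists (fun=> v) => *; exists a.
exists (Digraph A1), (Digraph A2); split.
- apply/negP=> D1T; apply: nL.
  have /containsP[f _ fP] : contains (revdi (Digraph A1)) T.
    (* Reversing twice gives back the arcs of [D1]. *)
    apply: self_converse_contains_rev => //; case/containsP: D1T => f fI fP.
    by apply/containsP; exists f => // u v /fP; rewrite !inE.
  by exists f => u v /fP; rewrite !inE => /existsP.
- apply/containsP=> -[f _ fP]; apply: nR.
  by exists f => u v /fP; rewrite inE => /existsP.
- apply/subsetP=> -[[a b] c] abc; rewrite !inE /=.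
  by apply/andP; split; apply/existsP; [exists c | exists a].
Qed.

Lemma pal_le_ex2 (V : finType) (T : digraph V) (m : nat) :
  self_converse T -> pal T m <= ex2 m T.
Proof.
move=> hself; apply/bigmax_leqP=> P /(pal_ok_sub_cherries _ _ _ _ hself).
case=> D1 [D2 [fr1 fr2 /subset_leq_card/leq_trans]]; apply.
have le2 (D : digraph 'I_m) : free_of T D -> outdeg2_sum D <= ex2 m T.
  by apply: (leq_bigmax_cond (F := fun D : digraph 'I_m => outdeg2_sum D)).
(* Doubling avoids halves: $2xy \le x^2 + y^2$ is applied at each vertex, and each sum of squares is
   at most [ex2 m T]. *)
rewrite card_cherries -(leq_pmul2l (isT : 0 < 2)) [leqRHS]mul2n -addnn.
apply: leq_trans (leq_add (le2 _ fr1) (le2 _ fr2)).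
rewrite big_distrr -big_split /=; apply: leq_sum => v _; exact: nat_Cauchy.
Qed.

Theorem theorem1p1 (V : finType) (T : digraph V) (hT : tournament T)
    (hself : self_converse T) (hV : 1 < #|V|) (m : nat) (hm : 1 <= m) :
  pal T m = ex2 m T.
Proof. by apply/eqP; rewrite eqn_leq pal_le_ex2 // ex2_le_pal. Qed.
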